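(* For every $n\ge3$, no vertex of the unweighted path $P_n$ is sedentary.
   Context: For a graph with adjacency matrix $A$, $U(t)=e^{itA}$. A vertex $u$ is sedentary if $\inf_{t>0}|U(t)_{u,u}|\ge C$ for some constant $0<C\le1$, and not sedentary if $\inf_{t>0}|U(t)_{u,u}|=0$. *)

(* Defs.v *)
From HB Require Import structures.
From mathcomp Require Import all_boot all_order all_algebra.
From mathcomp Require Import all_classical all_reals all_analysis.
From mathcomp Require Import complex.
Set Implicit Arguments. Unset Strict Implicit. Unset Printing Implicit Defensive.
Import Order.TTheory GRing.Theory Num.Theory.
Import numFieldNormedType.Exports.
Local Open Scope ring_scope.
Local Open Scope complex_scope.

Definition path_adj (R : realType) (n : nat) : 'M[R]_n :=
  \matrix_(i < n, j < n) (((i.+1 == j) || (j.+1 == i))%N)%:R.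

Definition expmx (R : realType) (n : nat) (M : 'M[R[i]]_n) : 'M[R[i]]_n :=
  limn (series (fun k : nat => (k`!%:R)^-1 *: M ^+ k)).

Definition transition (R : realType) (n : nat) (A : 'M[R]_n) (t : R)
  : 'M[R[i]]_n :=
  expmx ((('i * t%:C) : R[i]) *: map_mx (fun x : R => x%:C) A).

Definition cmod (R : realType) (z : R[i]) : R := Normc.normc z.

Definition sedentary (R : realType) (n : nat) (A : 'M[R]_n) (u : 'I_n) : Prop :=
  exists C : R, 0 < C <= 1 /\
    (C <= inf [set cmod (transition A t u u) | t in [set t : R | 0 < t]])%R.

Definition not_sedentary (R : realType) (n : nat) (A : 'M[R]_n) (u : 'I_n) : Prop :=
  inf [set cmod (transition A t u u) | t in [set t : R | 0 < t]] = 0.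

(* Main.v *)
(** The return amplitude of the path at [u] is the real trigonometric polynomial
    f(t) = sum_k w_k cos (lambda_k t), with lambda_k = 2 cos (k pi / (n+1)) and
    w_k = 2/(n+1) sin^2 (u k pi / (n+1)).  If |f| were bounded below by e > 0 on t > 0,
    then f >= e by the intermediate value theorem, as f(0) = 1, and this is refuted by
    averaging.  The plain mean of f is the weight of the eigenvalue 0, which vanishes
    unless n and u are odd.  When n + 1 = 2m with m >= 3 and u odd, one averages f
    against (1 - cos (x t)) (1 - cos (y t)), where x = lambda_a and y = lambda_(m-a)
    with a the integer just below m/2.  The weights of x and y add up to that of 0, x + y
    exceeds the spectrum and x - y falls in a gap of it, so this mean is 0.  For n = 3,
    f(pi / lambda_1) = 0. *)

Require Import Defs.
From HB Require Import structures.
From mathcomp Require Import all_boot all_order all_algebra.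
From mathcomp Require Import all_classical all_reals all_analysis.
From mathcomp Require Import complex.
From mathcomp Require Import ring lra zify.
Import Order.TTheory GRing.Theory Num.Theory.
Import numFieldNormedType.Exports.
Local Open Scope classical_set_scope.
Local Open Scope complex_scope.
Local Open Scope ring_scope.

(** * Entrywise spectral form of the matrix exponential *)

Lemma cvg_complex {R : realType} (a b : nat -> R) (x y : R) :
  a @ \oo --> x -> b @ \oo --> y ->
  (fun k => (a k +i* b k : (R[i] : numFieldType))) @ \oo -->
  (x +i* y : (R[i] : numFieldType)).
Proof.
move=> /cvgrPdist_lt ax /cvgrPdist_lt yb; apply/cvgrPdist_lt => e.
rewrite ltcE /= => /andP[/eqP Ie Re0].
have -> : e = (complex.Re e)%:C by case: e Ie Re0 => ? ? /= ->.
(* With half of [e] for each coordinate, the squares add up to at most half of the square of [e]. *)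
have h : 0 < complex.Re e / 2 by rewrite divr_gt0.
near=> k.
have Ak : `|x - a k| < complex.Re e / 2 by near: k; exact: ax.
have Bk : `|y - b k| < complex.Re e / 2 by near: k; exact: yb.
rewrite normc_def ltcR /=.
have e0 : complex.Re e = Num.sqrt (complex.Re e ^+ 2) by rewrite sqrtr_sqr gtr0_norm.
rewrite [ltRHS]e0 ltr_sqrt ?exprn_gt0 //.
have Ak2 : `|x - a k| ^+ 2 <= (complex.Re e / 2) ^+ 2 by rewrite lerXn2r ?nnegrE ?normr_ge0 // ltW.
have Bk2 : `|y - b k| ^+ 2 <= (complex.Re e / 2) ^+ 2 by rewrite lerXn2r ?nnegrE ?normr_ge0 // ltW.
rewrite !real_normK ?num_real // in Ak2 Bk2.
have : 0 < complex.Re e ^+ 2 by rewrite exprn_gt0.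
move: Ak2 Bk2; rewrite !expr_div_n.
move: ((x - a k) ^+ 2) ((y - b k) ^+ 2) (complex.Re e ^+ 2) => p q r.
lra.
Unshelve. all: by end_near.
Qed.

Lemma cvg_mx {T : ptopologicalType} (n m : nat) (s : nat -> 'M[T]_(n, m))
    (M : 'M[T]_(n, m)) :
  (forall i j, (fun k => s k i j) @ \oo --> M i j) -> s @ \oo --> M.
Proof.
move=> H A [P MP sPA].
have : \forall k \near \oo, forall i j, P i j (s k i j).
  apply: filter_forall => i; apply: filter_forall => j; exact: (H i j _ (MP i j)).
by apply: filterS => k /sPA.
Qed.

Lemma exp_coeff_complex {R : realType} (x : R) (j : nat) :
  (j`!%:R)^-1 * ('i%C * x%:C : R[i]) ^+ j = cos_coeff x j +i* sin_coeff x j.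
Proof.
rewrite /cos_coeff /sin_coeff /=.
(* The powers of i are put in the shape of [cos_coeff] and [sin_coeff], with parity factors and
   halved exponents. *)
have iE : 'i%C ^+ j = ((~~ odd j)%:R * (-1) ^+ j./2) +i* ((odd j)%:R * (-1) ^+ j.-1./2) :> R[i].
  rewrite -{1}(odd_double_half j) exprD -mul2n exprM sqr_i.
  have -> : (-1 : R[i]) ^+ j./2 = ((-1) ^+ j./2)%:C by rewrite rmorphXn rmorphN1.
  have [oj|oj] := boolP (odd j); rewrite /= ?expr1 ?expr0 ?mul0r ?mul1r; simpc => //.
  by case: j oj => // j /= oj; rewrite uphalf_half (negbTE oj).
rewrite exprMn iE -rmorphXn -(rmorph_nat (real_complex R)) -fmorphV mulrC; simpc.
by [].
Qed.

Lemma lim_mx {K : numFieldType} (n m : nat) (s : nat -> 'M[K]_(n, m))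
    (M : 'M[K]_(n, m)) :
  (forall i j, (fun k => s k i j) @ \oo --> M i j) -> limn s = M.
Proof. by move=> /cvg_mx sM; apply: (cvg_lim _ sM); exact: norm_hausdorff. Qed.

Lemma series_sum {R : realType} {I : finType} (a : I -> R) (s : I -> nat -> R) k :
  series (fun j => \sum_i a i * s i j) k = \sum_i a i * series (s i) k.
Proof. by rewrite /series /= exchange_big; apply: eq_bigr => i _; rewrite mulr_sumr. Qed.

Lemma cvg_series_lincomb {R : realType} {I : finType} (a l : I -> R)
    (s : I -> nat -> R) :
  (forall i, series (s i) @ \oo --> l i) ->
  series (fun j => \sum_i a i * s i j) @ \oo --> \sum_i a i * l i.
Proof.
move=> H; rewrite (_ : series _ = fun k => \sum_i a i * series (s i) k).
  by apply: cvg_big => [|i _]; [exact: add_continuous|exact: cvgMr].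
by apply/funext => k; exact: series_sum.
Qed.

Lemma sum_complex {R : realType} {I : Type} (r : seq I) (P : pred I) (a b : I -> R) :
  \sum_(i <- r | P i) (a i +i* b i) =
  (\sum_(i <- r | P i) a i) +i* (\sum_(i <- r | P i) b i) :> R[i].
Proof.
by elim/big_rec3: _ => [//|i x y _ _ ->]; simpc.
Qed.

(** A formula for the powers of [A] suffices: through it, each entry of the exponential series is a
    finite combination of cosine and sine series. *)
Lemma transition_spectral {R : realType} {n : nat} {I : finType} (A : 'M[R]_n)
    (w : 'I_n -> 'I_n -> I -> R) (lam : I -> R) (t : R) (u v : 'I_n) :
  (forall j u v, (A ^+ j) u v = \sum_k w u v k * lam k ^+ j) ->
  transition A t u v = (\sum_k w u v k * cos (t * lam k)) +i*
                       (\sum_k w u v k * sin (t * lam k)).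
Proof.
move=> Apow.
pose M : 'M[R[i]]_n := \matrix_(u, v) ((\sum_k w u v k * cos (t * lam k)) +i*
                       (\sum_k w u v k * sin (t * lam k))).
suff -> : transition A t = M by rewrite mxE.
apply: (@lim_mx (R[i] : numFieldType)) => {}u {}v; rewrite mxE.
have termE j : ((j`!%:R)^-1 *: (('i%C * t%:C : R[i]) *: map_mx (fun x => x%:C) A) ^+ j) u v
   = (\sum_k w u v k * cos_coeff (t * lam k) j) +i* (\sum_k w u v k * sin_coeff (t * lam k) j).
  have -> : (('i%C * t%:C : R[i]) *: map_mx (real_complex R) A) ^+ j =
     ('i%C * t%:C : R[i]) ^+ j *: map_mx (real_complex R) (A ^+ j).
    elim: j => [|j IH]; first by rewrite !expr0 scale1r map_mx1.
    by rewrite !exprS IH -!mulmxE map_mxM -scalemxAl -scalemxAr scalerA.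
  rewrite !mxE Apow rmorph_sum -sum_complex mulr_sumr mulr_sumr.
  apply: eq_bigr => k _; rewrite /= rmorphM rmorphXn /=.
  transitivity ((w u v k)%:C * ((j`!%:R)^-1 * ('i%C * (t * lam k)%:C) ^+ j)).
    by rewrite rmorphM /= !exprMn; ring.
  by rewrite exp_coeff_complex; simpc.
rewrite (_ : (fun k => _) = fun k =>
   (series (fun j => \sum_k w u v k * cos_coeff (t * lam k) j) k +i*
    series (fun j => \sum_k w u v k * sin_coeff (t * lam k) j) k : (R[i] : numFieldType))).
  apply: cvg_complex; apply: cvg_series_lincomb => k.
    by rewrite unlock; exact: is_cvg_series_cos_coeff.
  by rewrite unlock; exact: is_cvg_series_sin_coeff.
apply/funext => N; rewrite /series /= -sum_complex summxE.
by apply: eq_bigr => j _; exact: termE.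
Qed.

(** * Sine eigenvectors and spectral decomposition of the path *)

Lemma sin_natpi {R : realType} (k : nat) : sin (k%:R * pi) = 0 :> R.
Proof. by elim: k => [|k IH]; rewrite ?mul0r ?sin0 // -natr1 mulrDl mul1r sinDpi IH oppr0. Qed.

Lemma cos_natpi {R : realType} (k : nat) : cos (k%:R * pi) = (-1) ^+ k :> R.
Proof.
elim: k => [|k IH]; first by rewrite mul0r cos0.
by rewrite -natr1 mulrDl mul1r cosDpi IH exprS mulN1r.
Qed.

(** Telescoping, since 2 sin (y/2) cos c = sin (c + y/2) - sin (c - y/2). *)
Lemma sum_cos_arith {R : realType} (y z : R) (M : nat) :
  2 * sin (y / 2) * \sum_(k < M) cos (k%:R * y + z) =
  sin (M%:R * y + z - y / 2) - sin (z - y / 2).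
Proof.
elim: M => [|M IH]; first by rewrite big_ord0 mulr0 mul0r add0r subrr.
rewrite big_ord_recr /= mulrDr IH -[M.+1%:R]natr1.
have -> : (M%:R + 1) * y + z - y / 2 = (M%:R * y + z) + y / 2 by field.
rewrite (sinD _ (y / 2)) (sinB (M%:R * y + z)); ring.
Qed.

(** The range of [j] keeps y/2 = j pi / (2N) strictly between 0 and pi, so the factor sin (y/2) of
    [sum_cos_arith] can be cancelled. *)
Lemma sum_cos_root {R : realType} (N j : nat) : (0 < j < N.*2)%N ->
  2 * \sum_(k < N) cos (k%:R * (j%:R * pi / N%:R)) = 1 - (-1) ^+ j :> R.
Proof.
move=> /andP[j0 jN].
have N0 : 0 < N%:R :> R by rewrite ltr0n; lia.
set y := j%:R * pi / N%:R.
have s0 : 0 < sin (y / 2).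
  have -> : y / 2 = pi * (j%:R / (N.*2)%:R).
    by rewrite /y -mul2n natrM; field; rewrite gt_eqF.
  apply: sin_gt0_pi; rewrite mulr_gt0 ?pi_gt0 ?divr_gt0 ?ltr0n ?(leq_trans _ jN) //=.
  by rewrite gtr_pMr ?pi_gt0 // ltr_pdivrMr ?mul1r ?ltr_nat // ltr0n (leq_trans _ jN).
have := sum_cos_arith y 0 N; under eq_bigr do rewrite addr0.
have -> : N%:R * y + 0 - y / 2 = j%:R * pi - y / 2 by rewrite /y; field; rewrite gt_eqF.
rewrite (sinB (j%:R * pi)) sin_natpi cos_natpi sub0r sinN => H.
apply: (mulfI (lt0r_neq0 s0)); rewrite mulrA [sin _ * 2]mulrC H; ring.
Qed.

(** Product-to-sum leaves two cosine sums, at u - v and u + v + 2. These have the same parity, so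
    [sum_cos_root] gives them equal values, unless u = v, where the first sum is n + 1 and the
    second is 0. *)
Lemma sum_sin_orthogonal {R : realType} (n : nat) (u v : 'I_n) :
  \sum_(k < n) sin (u.+1%:R * (k.+1%:R * pi / n.+1%:R)) *
               sin (v.+1%:R * (k.+1%:R * pi / n.+1%:R)) =
  n.+1%:R / 2 * (u == v)%:R :> R.
Proof.
wlog vu : u v / (v <= u)%N.
  move=> H; have [|/ltnW uv] := leqP v u; first exact: H.
  by rewrite eq_sym -H //; apply: eq_bigr => k _; rewrite mulrC.
pose g (k : nat) : R := sin (u.+1%:R * (k%:R * pi / n.+1%:R)) *
               sin (v.+1%:R * (k%:R * pi / n.+1%:R)).
(* Adding the vanishing term of index 0 gives the full range of n + 1 terms. *)
have -> : \sum_(k < n) sin (u.+1%:R * (k.+1%:R * pi / n.+1%:R)) *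
               sin (v.+1%:R * (k.+1%:R * pi / n.+1%:R)) = \sum_(k < n.+1) g k.
  have g0 : g 0%N = 0 by rewrite /g !mul0r !mulr0 sin0 mul0r.
  by rewrite [RHS]big_ord_recl g0 add0r.
pose C j : R := \sum_(k < n.+1) cos (k%:R * (j%:R * pi / n.+1%:R)).
have gC : 2 * \sum_(k < n.+1) g k = C (u - v)%N - C (u.+1 + v.+1)%N.
  rewrite mulr_sumr /C -sumrB; apply: eq_bigr => k _; rewrite /g.
  set a := u.+1%:R * _; set b := v.+1%:R * _.
  have -> : k%:R * ((u - v)%:R * pi / n.+1%:R) = a - b.
    by rewrite natrB // /a /b -[u.+1%:R]natr1 -[v.+1%:R]natr1; ring.
  have -> : k%:R * ((u.+1 + v.+1)%:R * pi / n.+1%:R) = a + b.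
    by rewrite natrD /a /b; ring.
  by rewrite cosB cosD; ring.
have h2 : 2 * C (u.+1 + v.+1)%N = 1 - (-1) ^+ (u + v).
  rewrite sum_cos_root.
    by rewrite addSn addnS !exprS !mulN1r opprK.
  by have := ltn_ord u; have := ltn_ord v; lia.
apply: (@mulfI _ 4); first by rewrite pnatr_eq0.
have -> : 4 * \sum_(k < n.+1) g k = 2 * C (u - v)%N - 2 * C (u.+1 + v.+1)%N.
  by rewrite -mulrBr -gC; ring.
rewrite h2; have [<-|uv] := eqVneq u v.
  rewrite subnn addnn -mul2n exprM sqrrN !expr1n subrr subr0 /C.
  under eq_bigr do rewrite !mul0r mulr0 cos0.
  by rewrite sumr_const card_ord mulr1 -[_ *+ n.+1]mulr_natr; field.
have {}vu : (v < u)%N by rewrite ltn_neqAle vu andbT eq_sym.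
rewrite sum_cos_root; last by have := ltn_ord u; lia.
rewrite !mulr0 -(signr_odd _ (u - v)) -(signr_odd _ (u + v)) oddB ?oddD ?subrr //.
exact: ltnW.
Qed.

Definition path_eigenvalue (R : realType) (n k : nat) : R :=
  2 * cos (k%:R * pi / n.+1%:R).

(** Entry (u, v) of the projection onto the k-th eigenspace. All indices count from 1, whereas
    ordinals count from 0; hence the successors at every use. *)
Definition path_eigenweight (R : realType) (n u v k : nat) : R :=
  2 / n.+1%:R * (sin (u%:R * (k%:R * pi / n.+1%:R)) * sin (v%:R * (k%:R * pi / n.+1%:R))).

(** The sine vector vanishes at the fictitious vertices 0 and n + 1, so end vertices obey the same
    rule as inner ones: sin (c + y) + sin (c - y) = 2 cos y sin c. *)
Lemma path_adj_eigenvector {R : realType} (n : nat) (y : R) (u : 'I_n) :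
  sin (n.+1%:R * y) = 0 ->
  \sum_v path_adj R n u v * sin (v.+1%:R * y) = 2 * cos y * sin (u.+1%:R * y).
Proof.
move=> sN.
have up : \sum_(v < n) (u.+1 == v)%:R * sin (v.+1%:R * y) = sin (u.+2%:R * y).
  have [un|nu] := ltnP u.+1 n.
    rewrite (bigD1 (Ordinal un)) //= eqxx mul1r big1 ?addr0 // => v.
    by rewrite -val_eqE /= eq_sym => /negbTE ->; rewrite mul0r.
  have -> : u.+2 = n.+1 by have := ltn_ord u; lia.
  rewrite sN big1 // => v _; suff /negbTE -> : u.+1 != v by rewrite mul0r.
  by have := ltn_ord v; lia.
have down : \sum_(v < n) (v.+1 == u)%:R * sin (v.+1%:R * y) = sin (u%:R * y).
  case: u {up} => -[|u] un /=.
    by rewrite mul0r sin0 big1 // => v _; rewrite mul0r.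
  rewrite (bigD1 (Ordinal (ltnW un))) //= eqxx mul1r big1 ?addr0 // => v.
  by rewrite -val_eqE /= eqSS => /negbTE ->; rewrite mul0r.
transitivity (\sum_(v < n) ((u.+1 == v)%:R * sin (v.+1%:R * y) +
                            (v.+1 == u)%:R * sin (v.+1%:R * y))).
  apply: eq_bigr => v _; rewrite mxE -mulrDl; congr (_ * _).
  have [<-|_] := eqVneq u.+1 v; last by rewrite add0r.
  by rewrite (_ : (u.+2 == u) = false) ?addr0 //; lia.
rewrite big_split /= up down.
have -> : u.+2%:R * y = u.+1%:R * y + y by rewrite -[u.+2%:R]natr1; ring.
have -> : u%:R * y = u.+1%:R * y - y by rewrite -[u.+1%:R]natr1; ring.
by rewrite sinD sinB; ring.
Qed.

(** Induction on [j]: the base case is [sum_sin_orthogonal], and each further factor of the matrix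
    brings out one eigenvalue. *)
Lemma path_adj_expE {R : realType} (n j : nat) (u v : 'I_n) :
  (path_adj R n ^+ j) u v =
  \sum_(k < n) path_eigenweight R n u.+1 v.+1 k.+1 * path_eigenvalue R n k.+1 ^+ j.
Proof.
have N0 : n.+1%:R != 0 :> R by rewrite pnatr_eq0.
elim: j u v => [|j IH] u v.
  rewrite expr0; under eq_bigr do rewrite expr0 mulr1.
  by rewrite -mulr_sumr sum_sin_orthogonal mxE mulrA; field.
rewrite exprS -mulmxE mxE; under eq_bigr do rewrite IH mulr_sumr.
rewrite exchange_big /=; apply: eq_bigr => k _.
set y : R := k.+1%:R * pi / n.+1%:R.
transitivity ((2 / n.+1%:R * sin (v.+1%:R * y) * path_eigenvalue R n k.+1 ^+ j) *
   (\sum_w path_adj R n u w * sin (w.+1%:R * y))).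
  by rewrite mulr_sumr; apply: eq_bigr => w _; rewrite /path_eigenweight -/y; ring.
rewrite path_adj_eigenvector; last first.
  by rewrite /y mulrC divfK // sin_natpi.
by rewrite exprS /path_eigenweight {2}/path_eigenvalue -/y; ring.
Qed.

(** * The return amplitude and the reflection symmetry of the spectrum *)

Definition path_return (R : realType) (n u : nat) (t : R) : R :=
  \sum_(k < n) path_eigenweight R n u u k.+1 * cos (t * path_eigenvalue R n k.+1).

Lemma path_eigenvalueN {R : realType} (n k : nat) : (k <= n.+1)%N ->
  path_eigenvalue R n (n.+1 - k) = - path_eigenvalue R n k.
Proof.
move=> kn; rewrite /path_eigenvalue -mulrN; congr (_ * _).
have -> : (n.+1 - k)%:R * pi / n.+1%:R = - (k%:R * pi / n.+1%:R) + pi :> R.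
  by rewrite natrB // mulrBl mulrBl [n.+1%:R * pi]mulrC mulfK ?pnatr_eq0 //; ring.
by rewrite cosDpi cosN.
Qed.

Lemma path_eigenweightN {R : realType} (n u k : nat) : (k <= n.+1)%N ->
  path_eigenweight R n u u (n.+1 - k) = path_eigenweight R n u u k.
Proof.
move=> kn; rewrite /path_eigenweight; congr (_ * _).
set y := k%:R * pi / n.+1%:R.
have -> : u%:R * ((n.+1 - k)%:R * pi / n.+1%:R) = u%:R * pi - u%:R * y :> R.
  rewrite natrB // mulrBl mulrBl mulrBr; congr (_ - _); congr (_ * _).
    by rewrite [n.+1%:R * pi]mulrC mulfK ?pnatr_eq0.
rewrite sinB sin_natpi cos_natpi mul0r sub0r mulrNN.
by rewrite mulrACA -expr2 -exprM mulnC exprM sqrrN !expr1n mul1r.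
Qed.

Lemma transition_path {R : realType} (n : nat) (u : 'I_n) (t : R) :
  transition (path_adj R n) t u u = (path_return R n u.+1 t)%:C.
Proof.
rewrite (transition_spectral _
  (fun (u v k : 'I_n) => path_eigenweight R n u.+1 v.+1 k.+1)
  (fun k : 'I_n => path_eigenvalue R n k.+1)); last first.
  by move=> j a b; exact: path_adj_expE.
rewrite /path_return; congr (_ +i* _).
(* The imaginary part is odd under the reflection of [k] to n + 1 - k, which keeps weights and
   negates eigenvalues. *)
set s := \sum_k _; suff : s = - s by lra.
rewrite {1}/s (reindex_inj rev_ord_inj) /= -sumrN; apply: eq_bigr => k _.
have -> : (n - k.+1).+1 = (n.+1 - k.+1)%N by have := ltn_ord k; lia.
by rewrite path_eigenweightN ?path_eigenvalueN ?mulrN ?sinN ?mulrN // ltnW // ltnS.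
Qed.

Lemma path_return0 {R : realType} (n : nat) (u : 'I_n) : path_return R n u.+1 0 = 1.
Proof.
have := @path_adj_expE R n 0 u u; rewrite expr0 mxE eqxx => E1.
rewrite -[RHS]/(true%:R : R) E1.
by apply: eq_bigr => k _; rewrite mul0r cos0 expr0.
Qed.

Lemma continuous_path_return {R : realType} (n u : nat) :
  continuous (path_return R n u).
Proof.
apply: (@continuous_big _ _ +%R) => [|k _]; first exact: add_continuous.
move=> t; apply: cvgMr; apply: continuous_comp; last exact: continuous_cos.
by apply: cvgMl; exact: cvg_id.
Qed.

(** * Discrete means of trigonometric sums *)

(** A mean over the positive samples 1/2, 1, 3/2, ... in place of an integral. Asking for a bounded
    error of the partial sums, which is stronger than convergence of the averages, makes linearity
    immediate. *)
Definition has_mean {R : realType} (g : R -> R) (a : R) : Prop :=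
  exists B, forall M : nat, `|\sum_(l < M) g (l.+1%:R / 2) - M%:R * a| <= B.

Lemma eq_has_mean {R : realType} (g h : R -> R) (a : R) :
  g =1 h -> has_mean g a -> has_mean h a.
Proof. by move=> /funext ->. Qed.

Lemma has_meanZ {R : realType} (c : R) (g : R -> R) (a : R) :
  has_mean g a -> has_mean (fun t => c * g t) (c * a).
Proof.
case=> B gB; exists (`|c| * B) => M; rewrite -mulr_sumr mulrCA -mulrBr normrM.
by rewrite ler_wpM2l.
Qed.

Lemma has_meanD {R : realType} (g h : R -> R) (a b : R) :
  has_mean g a -> has_mean h b -> has_mean (fun t => g t + h t) (a + b).
Proof.
case=> B gB [C hC]; exists (B + C) => M; rewrite big_split mulrDr opprD addrACA.
by rewrite (le_trans (ler_normD _ _)) // lerD.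
Qed.

Lemma has_mean0 {R : realType} : has_mean (fun=> 0 : R) 0.
Proof. by exists 0 => M; rewrite big1 // mulr0 subrr normr0. Qed.

Lemma has_mean_sum {R : realType} {I : Type} (r : seq I) (g : I -> R -> R) (a : I -> R) :
  (forall i, has_mean (g i) (a i)) ->
  has_mean (fun t => \sum_(i <- r) g i t) (\sum_(i <- r) a i).
Proof.
move=> H; elim: r => [|i r IH].
  by rewrite big_nil; apply: eq_has_mean has_mean0 => t; rewrite big_nil.
rewrite big_cons; apply: eq_has_mean (has_meanD _ _ _ _ (H i) IH) => t.
by rewrite big_cons.
Qed.

(** The partial sums of h - g are nonnegative and stay within a constant of M (b - a), which is
    impossible for large [M] if b < a. *)
Lemma has_mean_le {R : realType} (g h : R -> R) (a b : R) :
  (forall t, 0 < t -> g t <= h t) -> has_mean g a -> has_mean h b -> a <= b.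
Proof.
move=> gh /(has_meanZ (-1)) ga hb; have [B HB] := has_meanD _ _ _ _ hb ga.
rewrite leNgt; apply/negP => ba.
have d0 : 0 < a - b by rewrite subr_gt0.
have [M BM] : exists M : nat, B / (a - b) < M%:R.
  exists (Num.bound `|B / (a - b)|).
  exact: le_lt_trans (ler_norm _) (archi_boundP (normr_ge0 _)).
have := HB M; rewrite ltr_pdivrMr // in BM; apply/negP; rewrite -ltNge.
apply: (lt_le_trans BM); rewrite (le_trans _ (ler_norm _)) // mulN1r -mulrN opprB.
rewrite lerDr sumr_ge0 // => l _.
by rewrite mulN1r subr_ge0 gh // divr_gt0 // ltr0n.
Qed.

(* Sampling with step 1/2 aliases a frequency with 0 only at multiples of 4 * pi; the
   crude bound 2 <= pi then leaves room for all frequencies below 8. *)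
Lemma has_mean_cos {R : realType} (mu : R) : `|mu| < 8 ->
  has_mean (fun t => cos (mu * t)) (mu == 0)%:R.
Proof.
move=> mu8; have [->|mu0] := eqVneq mu 0.
  exists 0 => M; under eq_bigr do rewrite mul0r cos0.
  by rewrite sumr_const card_ord mulr1 subrr normr0.
have s0 : sin (mu / 4) != 0.
  wlog: mu mu8 mu0 / 0 < mu.
    move=> H; have [/H->//|mn|] := ltgtP 0 mu; last by move=> /esym/eqP; rewrite (negbTE mu0).
    by rewrite -[mu]opprK mulNr sinN oppr_eq0 H ?normrN ?oppr_eq0 ?oppr_gt0.
  move=> m0; rewrite gtr0_norm // in mu8; rewrite gt_eqF // sin2_gt0 // divr_gt0 //=.
  lra.
(* By [sum_cos_arith] the sum is a difference of two sines, at most 2 in modulus, over 2 sin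
   (mu/4). *)
exists (`|sin (mu / 4)|^-1) => M.
have := sum_cos_arith (mu / 2) (mu / 2) M.
have -> : mu / 2 / 2 = mu / 4 by field.
set S := \sum_(k < M) cos (_ * _ + _).
have -> : \sum_(l < M) cos (mu * (l.+1%:R / 2)) = S.
  by apply: eq_bigr => l _; congr cos; rewrite -[l.+1%:R]natr1; field.
rewrite mulr0 subr0 => HS.
rewrite -[X in _ <= X]mul1r ler_pdivlMr ?normr_gt0 // -normrM.
have : `|2 * sin (mu / 4) * S| <= 2.
  by rewrite HS (le_trans (ler_normB _ _)) // (le_trans (lerD (sin_max _) (sin_max _))).
by rewrite -mulrA (normrM 2) normr_nat [S * _]mulrC; lra.
Qed.

(** * Spectral measure at a vertex and averages of the return amplitude *)

(** Mass at [x] of the spectral measure of [u]. It is defined for every real [x] and vanishes off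
    the spectrum, so sums and differences of eigenvalues can be inserted directly. *)
Definition spectral_weight (R : realType) (n u : nat) (x : R) : R :=
  \sum_(k < n) path_eigenweight R n u u k.+1 * (path_eigenvalue R n k.+1 == x)%:R.

Lemma path_eigenvalue_norm {R : realType} (n k : nat) : `|path_eigenvalue R n k| <= 2.
Proof. by rewrite normrM normr_nat ler_piMr // cos_max. Qed.

Lemma path_angle_itv {R : realType} (n k : nat) : (k <= n.+1)%N ->
  k%:R * pi / n.+1%:R \in `[0, pi : R].
Proof.
move=> kn; rewrite in_itv /= mulr_ge0 ?invr_ge0 ?ler0n ?mulr_ge0 ?pi_ge0 ?ler0n //=.
by rewrite ler_pdivrMr ?ltr0n // mulrC ler_pM2l ?pi_gt0 // ler_nat.
Qed.

Lemma path_eigenvalue_inj {R : realType} (n k l : nat) : (k <= n.+1)%N -> (l <= n.+1)%N ->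
  path_eigenvalue R n k = path_eigenvalue R n l -> k = l.
Proof.
move=> kn ln /mulfI; rewrite pnatr_eq0 => /(_ isT) /cos_inj.
move=> /(_ (path_angle_itv _ _ kn) (path_angle_itv _ _ ln)).
have N0 : n.+1%:R^-1 != 0 :> R by rewrite invr_eq0 pnatr_eq0.
by move=> /(mulIf N0) /(mulIf (lt0r_neq0 (pi_gt0 R))) /eqP; rewrite eqr_nat => /eqP.
Qed.

Lemma spectral_weight_eigenvalue {R : realType} (n u k : nat) : (0 < k <= n)%N ->
  spectral_weight R n u (path_eigenvalue R n k) = path_eigenweight R n u u k.
Proof.
case: k => // k /= kn; rewrite /spectral_weight (bigD1 (Ordinal kn)) //= eqxx mulr1.
rewrite big1 ?addr0 // => l lk; have [/path_eigenvalue_inj E|] := eqVneq; last by rewrite mulr0.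
by move: lk; rewrite -val_eqE /= -eqSS E ?eqxx // ltnW // ltnS.
Qed.

Lemma spectral_weight_eq0 {R : realType} (n u : nat) (x : R) :
  (forall k, (0 < k <= n)%N -> path_eigenvalue R n k = x ->
     path_eigenweight R n u u k = 0) -> spectral_weight R n u x = 0.
Proof.
move=> H; apply: big1 => k _; have [E|] := eqVneq; last by rewrite mulr0.
by rewrite H ?mul0r //=.
Qed.

Lemma spectral_weightN {R : realType} (n u : nat) (x : R) :
  spectral_weight R n u (- x) = spectral_weight R n u x.
Proof.
rewrite /spectral_weight (reindex_inj rev_ord_inj) /=; apply: eq_bigr => k _.
have -> : (n - k.+1).+1 = (n.+1 - k.+1)%N by have := ltn_ord k; lia.
by rewrite path_eigenweightN ?path_eigenvalueN ?eqr_opp // ltnW // ltnS.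
Qed.

(** The mean is half the weight at [x] plus half the weight at [- x], and these weights agree by
    [spectral_weightN]. The frequencies that occur are at most 2 + 4 < 8, within reach of
    [has_mean_cos]. *)
Lemma has_mean_path_return_cos {R : realType} (n u : nat) (x : R) : `|x| <= 4 ->
  has_mean (fun t => path_return R n u t * cos (x * t)) (spectral_weight R n u x).
Proof.
move=> x4; pose w k := path_eigenweight R n u u k; pose lam k := path_eigenvalue R n k.
have -> : spectral_weight R n u x =
    \sum_(k < n) w k.+1 / 2 * ((lam k.+1 - x == 0)%:R + (lam k.+1 + x == 0)%:R).
  have -> : spectral_weight R n u x =
      (spectral_weight R n u x + spectral_weight R n u (- x)) / 2.
    by rewrite spectral_weightN; field.
  rewrite -big_split /= mulr_suml; apply: eq_bigr => k _.
  by rewrite subr_eq0 addr_eq0 /w /lam; ring.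
apply: (eq_has_mean (fun t => \sum_(k < n) w k.+1 / 2 *
    (cos ((lam k.+1 - x) * t) + cos ((lam k.+1 + x) * t)))) => [t|].
  rewrite /path_return mulr_suml; apply: eq_bigr => k _.
  by rewrite mulrBl mulrDl cosB cosD [t * _]mulrC -/(lam _) -/(w _); field.
apply: has_mean_sum => k; apply: has_meanZ; apply: has_meanD; apply: has_mean_cos.
  have := path_eigenvalue_norm n k.+1 (R := R); rewrite -/(lam _) => h.
  by rewrite (le_lt_trans (ler_normB _ _)) //; lra.
have := path_eigenvalue_norm n k.+1 (R := R); rewrite -/(lam _) => h.
by rewrite (le_lt_trans (ler_normD _ _)) //; lra.
Qed.

Lemma path_return_lb_le_spectral_weight0 {R : realType} (n u : nat) (e : R) :
  (forall t, 0 < t -> e <= path_return R n u t) -> e <= spectral_weight R n u 0.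
Proof.
move=> H; have M0 : `|0 : R| < 8 by rewrite normr0.
have {}M0 := has_meanZ e _ _ (has_mean_cos 0 M0).
have M1 : `|0 : R| <= 4 by rewrite normr0.
have {}M1 := has_mean_path_return_cos n u 0 M1.
rewrite eqxx mulr1 in M0; apply: has_mean_le M0 M1 => t t0.
by rewrite mul0r cos0 !mulr1 H.
Qed.

(* Averaging against the Riesz product (1 - cos (x t)) (1 - cos (y t)), which is
   nonnegative and has mean 1. *)
Lemma path_return_lb_le_riesz {R : realType} (n u : nat) (e x y : R) :
  0 < x <= 2 -> 0 < y <= 2 -> x != y ->
  (forall t, 0 < t -> e <= path_return R n u t) ->
  e <= spectral_weight R n u 0 - spectral_weight R n u x - spectral_weight R n u y +
       2^-1 * spectral_weight R n u (x + y) + 2^-1 * spectral_weight R n u (x - y).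
Proof.
move=> /andP[x0 x2] /andP[y0 y2] xy H.
(* These are the Fourier coefficients of the Riesz product; the same functional serves for the
   functions and for their means. *)
pose lin (F : R -> R) := F 0 + (-1) * F x + (-1) * F y + 2^-1 * F (x + y) + 2^-1 * F (x - y).
have lin_mean (G : R -> R -> R) (F : R -> R) :
    (forall z, `|z| <= 4 -> has_mean (G z) (F z)) ->
    has_mean (fun t => lin (G ^~ t)) (lin F).
  move=> GF; do ![apply: has_meanD|apply: has_meanZ]; apply: GF;
    rewrite ler_norml; apply/andP; split; lra.
have lin_ge0 t : 0 <= lin (fun z => cos (z * t)).
  have -> : lin (fun z => cos (z * t)) = (1 - cos (x * t)) * (1 - cos (y * t)).
    by rewrite /lin mulrDl mulrBl cosD cosB mul0r cos0; field.
  by rewrite mulr_ge0 // subr_ge0 cos_le1.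
(* As x, y, x + y and x - y are all nonzero, only the constant term contributes to the mean. *)
have M1 : has_mean (fun t => e * lin (fun z => cos (z * t))) e.
  have := lin_mean (fun z t => cos (z * t)) (fun z => (z == 0)%:R) _.
  have xy0 : (x - y == 0) = false by rewrite subr_eq0 (negbTE xy).
  rewrite {2}/lin eqxx (gt_eqF x0) (gt_eqF y0) (gt_eqF (addr_gt0 x0 y0)) xy0.
  rewrite !mulr0 !addr0 => M; rewrite -[X in has_mean _ X]mulr1; apply: has_meanZ; apply: M.
  by move=> z z4; apply: has_mean_cos; lra.
have M2 := lin_mean (fun z t => path_return R n u t * cos (z * t)) (spectral_weight R n u)
   (has_mean_path_return_cos n u).
have := has_mean_le _ _ _ _ _ M1 M2; rewrite /lin !mulN1r; apply => t t0.
rewrite -/(lin _) -/(lin (fun z => path_return R n u t * cos (z * t))).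
have -> : lin (fun z => path_return R n u t * cos (z * t)) =
   path_return R n u t * lin (fun z => cos (z * t)) by rewrite /lin; ring.
by apply: ler_wpM2r; [exact: lin_ge0|exact: H].
Qed.

(** * The eigenvalue zero and the path on three vertices *)

Lemma sin_pihalf_even {R : realType} (u : nat) : ~~ odd u -> sin (u%:R * (pi / 2)) = 0 :> R.
Proof.
move=> ev; rewrite -(odd_double_half u) (negbTE ev) add0n -mul2n natrM.
have -> : 2 * (u./2)%:R * (pi / 2) = (u./2)%:R * pi :> R by field.
exact: sin_natpi.
Qed.

Lemma cos_pihalf_odd {R : realType} (u : nat) : odd u -> cos (u%:R * (pi / 2)) = 0 :> R.
Proof.
move=> od; rewrite -(odd_double_half u) od natrD -mul2n natrM.
have -> : (1 + 2 * (u./2)%:R) * (pi / 2) = (u./2)%:R * pi + pi / 2 :> R by field.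
by rewrite cosDpihalf sin_natpi oppr0.
Qed.

Lemma sqr_sin_pihalf_odd {R : realType} (u : nat) : odd u -> sin (u%:R * (pi / 2)) ^+ 2 = 1 :> R.
Proof. by move=> od; rewrite sin2cos2 cos_pihalf_odd // expr0n subr0. Qed.

(** A zero eigenvalue equals its negative, so by injectivity its index is fixed by the
    reflection. *)
Lemma path_eigenvalue_eq0 {R : realType} (n k : nat) : (k <= n.+1)%N ->
  path_eigenvalue R n k = 0 -> k.*2 = n.+1.
Proof.
move=> kn k0; apply: double_inj; rewrite -!addnn.
have : path_eigenvalue R n (n.+1 - k) = path_eigenvalue R n k.
  by rewrite path_eigenvalueN // k0 oppr0.
by move=> /path_eigenvalue_inj; rewrite leq_subr => /(_ isT kn); lia.
Qed.

Lemma path_angle_half {R : realType} (n k : nat) : k.*2 = n.+1 ->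
  k%:R * pi / n.+1%:R = pi / 2 :> R.
Proof.
move=> kn; rewrite -kn -mul2n natrM; field.
by rewrite pnatr_eq0; lia.
Qed.

(** For [n] even, 0 is not an eigenvalue; for [u] even, the eigenvector with angle pi/2 vanishes at
    [u]. *)
Lemma spectral_weight0_eq0 {R : realType} (n u : nat) : ~~ (odd u && odd n) ->
  spectral_weight R n u 0 = 0.
Proof.
move=> un; apply: spectral_weight_eq0 => k /andP[k0 kn].
move=> /path_eigenvalue_eq0 => /(_ (leqW kn)) k2.
rewrite /path_eigenweight path_angle_half // sin_pihalf_even ?mul0r ?mulr0 //.
by apply: contra un => ->; lia.
Qed.

Lemma path_eigenvalue_gt0 {R : realType} (n k : nat) : (k.*2 < n.+1)%N ->
  0 < path_eigenvalue R n k.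
Proof.
move=> kn; rewrite mulr_gt0 // cos_gt0_pihalf //.
have N0 : 0 < n.+1%:R :> R by rewrite ltr0n.
apply/andP; split.
  apply: (@lt_le_trans _ _ 0); first by rewrite oppr_lt0 divr_gt0 ?pi_gt0.
  by rewrite mulr_ge0 ?invr_ge0 ?ler0n // mulr_ge0 ?ler0n ?pi_ge0.
rewrite ltr_pdivrMr // mulrAC ltr_pdivlMr // mulrAC mulrC ltr_pM2l ?pi_gt0 //.
by rewrite -natrM ltr_nat muln2.
Qed.

(** For [u] odd the weights are 1/4, 1/2, 1/4, so the amplitude is (1 + cos (lambda_1 t)) / 2. *)
Lemma path_return_P3 {R : realType} (u : nat) : odd u ->
  path_return R 3 u (pi / path_eigenvalue R 3 1) = 0.
Proof.
move=> uo; have l0 : path_eigenvalue R 3 1 != 0 by rewrite gt_eqF // path_eigenvalue_gt0.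
rewrite /path_return !big_ord_recl big_ord0 /= /bump /=.
have -> : path_eigenvalue R 3 3 = - path_eigenvalue R 3 1 by rewrite -path_eigenvalueN.
have -> : path_eigenweight R 3 u u 3 = path_eigenweight R 3 u u 1 by rewrite -path_eigenweightN.
have -> : path_eigenvalue R 3 2 = 0.
  by rewrite /path_eigenvalue path_angle_half // cos_pihalf mulr0.
rewrite mulrN cosN divfK // cospi mulr0 cos0 /path_eigenweight.
rewrite (@path_angle_half _ 3 2) // -!expr2 sqr_sin_pihalf_odd //.
set y := u%:R * (1%:R * pi / 4%:R).
have : cos (y *+ 2) = 0.
  by rewrite -(cos_pihalf_odd u uo); congr cos; rewrite /y -mulr_natr; field.
by rewrite cos_mulr2n cos2sin2 => E; lra.
Qed.

(** * The two Riesz frequencies and the spectral gap *)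

(** The angles of indices [a] and [a + g] are complementary. As [u] is odd, their squared sines at
    [u] are a squared sine and cosine of one angle, adding up to the value 1 found at the middle
    index. *)
Lemma riesz_weight {R : realType} (n u a g : nat) : odd u -> (0 < a)%N -> (0 < g)%N ->
  n.+1 = (a.*2 + g).*2 ->
  spectral_weight R n u 0 - spectral_weight R n u (path_eigenvalue R n a)
     - spectral_weight R n u (path_eigenvalue R n (a + g)) = 0.
Proof.
move=> uo a0 g0 nE.
have h : (a.*2 + g).*2 = n.+1 by lia.
have l0 : path_eigenvalue R n (a.*2 + g) = 0.
  by rewrite /path_eigenvalue path_angle_half // cos_pihalf mulr0.
rewrite -[in spectral_weight R n u 0]l0 !spectral_weight_eigenvalue; try lia.
rewrite /path_eigenweight path_angle_half // -!expr2 sqr_sin_pihalf_odd //.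
set al := a%:R * pi / n.+1%:R.
have -> : (a + g)%:R * pi / n.+1%:R = pi / 2 - al.
  rewrite -(path_angle_half _ _ h) /al -mulrBl -mulrBl; congr (_ * _ / _).
  by rewrite -natrB; [congr (_%:R)|]; lia.
rewrite mulrBr sinB cos_pihalf_odd // mul0r subr0 exprMn sqr_sin_pihalf_odd // mul1r cos2sin2.
ring.
Qed.

Lemma sqr_path_eigenvalue {R : realType} (n k : nat) :
  path_eigenvalue R n k ^+ 2 = 2 + 2 * cos (2 * (k%:R * pi / n.+1%:R)).
Proof.
rewrite /path_eigenvalue exprMn; set y := _ / _.
by rewrite (mulr_natl y 2) cos_mulr2n; ring.
Qed.

(** With c = cos x in (0, 1), one has 2 c^2 - 1 < 2 c - 1 < c, that is cos (2x) < cos y < cos x; the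
    cosine decreases on [0, pi]. *)
Lemma cos_gap {R : realType} (x y : R) : 0 < x < pi / 2 -> 0 <= y <= pi ->
  cos y = 2 * cos x - 1 -> x < y < 2 * x.
Proof.
move=> /andP[x0 x2] yI E.
have c0 : 0 < cos x by rewrite cos_gt0_pihalf // x2 andbT; lra.
have c1 : cos x < 1.
  by rewrite -cos0 ltr_cos // in_itv /= ?lexx ?pi_ge0 // ltW //=; lra.
have xI : x \in `[0, pi] by rewrite in_itv /= ltW //=; lra.
have x2I : 2 * x \in `[0, pi] by rewrite in_itv /= mulr_ge0 ?ltW //=; lra.
have yI' : y \in `[0, pi] by rewrite in_itv.
rewrite -(ltr_cos xI yI') -(ltr_cos yI' x2I) E (mulr_natl x 2) cos_mulr2n; nra.
Qed.

(** With b = pi / (n + 1), equality would mean cos (2 j b) = 2 cos (g b) - 1 for some natural [j].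
    Then [cos_gap] forces g < 2j < 2g, which has no solution for g = 1 or 2. *)
Lemma path_eigenvalue_gap {R : realType} (n a g k : nat) : (0 < a)%N -> (0 < g <= 2)%N ->
  n.+1 = (a.*2 + g).*2 -> (0 < k <= n)%N ->
  path_eigenvalue R n k ^+ 2 <> 4 - 4 * cos (g%:R * (pi / n.+1%:R)).
Proof.
move=> a0 /andP[g0 g2] nE /andP[k0 kn]; rewrite sqr_path_eigenvalue.
set b : R := pi / n.+1%:R.
have b0 : 0 < b by rewrite divr_gt0 ?pi_gt0 ?ltr0n.
have piE : pi = (a.*2 + g)%:R * (2 * b).
  have m0 : (a.*2 + g)%:R != 0 :> R by rewrite pnatr_eq0; lia.
  by rewrite /b nE -[(_ + g).*2]mul2n natrM; move: (a.*2 + g)%:R m0 => m m0; field.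
(* Here [j] is the distance of [k] from the middle index, whose doubled angle is pi. *)
have [j [jm jE]] : exists j : nat, (j < a.*2 + g)%N /\
    cos (2 * (k%:R * pi / n.+1%:R)) = - cos (j%:R * (2 * b)).
  rewrite -(mulrA k%:R) -/b.
  have [km|mk] := leqP (a.*2 + g) k.
    exists (k - (a.*2 + g))%N; split; first lia.
    by rewrite -cosDpi; congr cos; rewrite piE natrB //; ring.
  exists (a.*2 + g - k)%N; split; first lia.
  rewrite -[cos (_ * (2 * b))]cosN -cosDpi; congr cos.
  by rewrite piE natrB ?(ltnW mk) //; ring.
rewrite jE => E.
have : g%:R * b < j%:R * (2 * b) < 2 * (g%:R * b).
  apply: cos_gap; last by lra.
    rewrite mulr_gt0 ?ltr0n //=.
    have -> : pi / 2 = (a.*2 + g)%:R * b by rewrite piE; field.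
    rewrite ltr_pM2r // ltr_nat; lia.
  have b20 : 0 < 2 * b by rewrite mulr_gt0.
  apply/andP; split; first by apply: mulr_ge0; [exact: ler0n|exact: ltW].
  by rewrite piE ler_pM2r // ler_nat ltnW.
rewrite [j%:R * _]mulrA [2 * (g%:R * b)]mulrA !ltr_pM2r // -!natrM !ltr_nat.
by lia.
Qed.

(** * Failure of positive lower bounds and vanishing of the infimum *)

Lemma path_return_no_lower_bound {R : realType} (n u : nat) (e : R) : (3 <= n)%N -> 0 < e ->
  ~ (forall t, 0 < t -> e <= path_return R n u t).
Proof.
move=> n3 e0 H; suff : e <= 0 by rewrite leNgt e0.
have [/andP[uo no]|un] := boolP (odd u && odd n); last first.
  by rewrite -(spectral_weight0_eq0 n u un) path_return_lb_le_spectral_weight0.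
have [nE|n3'] := eqVneq n 3%N.
  rewrite nE in H; rewrite -(path_return_P3 u uo) H // divr_gt0 ?pi_gt0 // path_eigenvalue_gt0 //.
(* With m = (n + 1)/2, the parity choice of [g] makes m - g even, so m = 2a + g; as m >= 3, [a] is
   positive. *)
pose g := if odd n.+1./2 then 1%N else 2%N; pose a := ((n.+1./2 - g)./2)%N.
have g12 : (0 < g <= 2)%N by rewrite /g; case: ifP.
have [a0 nE] : (0 < a)%N /\ n.+1 = (a.*2 + g).*2.
  have nE : n.+1 = n.+1./2.*2 by lia.
  have : (3 <= n.+1./2)%N by lia.
  rewrite /a /g; case: ifP; lia.
have {g12} /andP[g0 g2] := g12.
set x := path_eigenvalue R n a; pose y := path_eigenvalue R n (a + g).
have x0 : 0 < x by apply: path_eigenvalue_gt0; lia.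
have y0 : 0 < y by apply: path_eigenvalue_gt0; lia.
have le2 k : path_eigenvalue R n k <= 2.
  exact: le_trans (ler_norm _) (path_eigenvalue_norm _ _).
have xy : x != y by apply/eqP => /path_eigenvalue_inj; lia.
have angleD : a%:R * pi / n.+1%:R + (a + g)%:R * pi / n.+1%:R = pi / 2 :> R.
  have h : (a.*2 + g).*2 = n.+1 by [].
  by rewrite -(path_angle_half _ _ h) -mulrDl -mulrDl -natrD; congr (_%:R * _ / _); lia.
have sqD : x ^+ 2 + y ^+ 2 = 4.
  rewrite !sqr_path_eigenvalue.
  have -> : 2 * ((a + g)%:R * pi / n.+1%:R) = - (2 * (a%:R * pi / n.+1%:R)) + pi :> R.
    by rewrite -(addKr (a%:R * pi / n.+1%:R) ((a + g)%:R * pi / n.+1%:R)) angleD; field.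
  by rewrite cosDpi cosN; ring.
have xyE : x * y = 2 * cos (g%:R * (pi / n.+1%:R)).
  have -> : g%:R * (pi / n.+1%:R) = (a + g)%:R * pi / n.+1%:R - a%:R * pi / n.+1%:R :> R.
    by rewrite -!mulrBl -natrB ?leq_addr // addKn mulrA.
  rewrite -[RHS]addr0 -(mulr0 2) -cos_pihalf -angleD cosB cosD /x /y /path_eigenvalue; ring.
have xI : 0 < x <= 2 by rewrite x0 le2.
have yI : 0 < y <= 2 by rewrite y0 le2.
have := path_return_lb_le_riesz n u e x y xI yI xy H.
rewrite riesz_weight // !(spectral_weight_eq0 n u) ?mulr0 ?addr0 //.
  (* The difference: (x - y)^2 = 4 - 2xy is the value excluded by the gap. *)
  move=> k kn E; exfalso; apply: (path_eigenvalue_gap n a g k a0 _ nE kn (R := R)).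
    by rewrite g0 g2.
  by rewrite E; have := sqD; have := xyE; nra.
(* The sum: (x + y)^2 = 4 + 2xy > 4, while eigenvalues have modulus at most 2. *)
move=> k kn E; have := path_eigenvalue_norm n k (R := R); rewrite E ger0_norm; last lra.
have := mulr_gt0 x0 y0; nra.
Qed.

Lemma path_return_small {R : realType} (n : nat) (u : 'I_n) (e : R) : (3 <= n)%N -> 0 < e ->
  exists2 t, 0 < t & `|path_return R n u.+1 t| < e.
Proof.
move=> n3 e0; apply: contrapT => H.
have far t : 0 < t -> e <= `|path_return R n u.+1 t|.
  by move=> t0; rewrite leNgt; apply/negP => ft; apply: H; exists t.
apply: (path_return_no_lower_bound n u.+1 e n3 e0) => t t0.
rewrite -[leRHS]ger0_norm ?far // leNgt; apply/negP => ft.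
(* A negative value at [t] yields a zero in [0, t], and not at 0, where the amplitude is 1. *)
have [|||s sI fs] := @IVT R (path_return R n u.+1) 0 t 0.
- exact: ltW.
- exact/continuous_subspaceT/continuous_path_return.
- by rewrite path_return0 ge_min (ltW ft) orbT le_max ler01.
have s0 : 0 < s.
  move: sI; rewrite in_itv /= => /andP[]; rewrite le_eqVlt => /predU1P[s0|//].
  by move: fs; rewrite -s0 path_return0 => /eqP; rewrite oner_eq0.
by have := far s s0; rewrite fs normr0 leNgt e0.
Qed.

Theorem theorem43 (R : realType) (n : nat) (hn : (3 <= n)%N) (u : 'I_n) :
  ~ sedentary (path_adj R n) u /\ not_sedentary (path_adj R n) u.
Proof.
suff inf0 : not_sedentary (path_adj R n) u.
  by split=> // -[C [/andP[C0 _]]]; rewrite inf0 leNgt C0.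
rewrite /not_sedentary; set S := [set _ | _ in _].
have S_ge0 : lbound S 0.
  move=> _ [t _ <-]; rewrite /cmod; case: (transition _ _ _ _) => a b.
  exact: sqrtr_ge0.
apply/eqP; rewrite eq_le; apply/andP; split; last first.
  apply: lb_le_inf => //; exists (cmod (transition (path_adj R n) 1 u u)).
  by exists 1 => //=.
(* A positive infimum could itself serve as the tolerance, and some modulus would fall below it. *)
rewrite leNgt; apply/negP => /(path_return_small n u _ hn)[t t0].
apply/negP; rewrite -leNgt; apply: ge_inf; first by exists 0.
exists t => //.
by rewrite transition_path /cmod /= expr0n addr0 sqrtr_sqr.
Qed.
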